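(* Let $n\ge 1$ and $k\ge 0$ be integers and let $G$ be a simple connected graph of order $n$ with exactly $k$ cut edges. Then $$RDD(G)\le n^3-\left(\tfrac{5}{2}k+2\right)n^2+\left(2k^2+\tfrac{11}{2}k+1\right)n-\left(\tfrac{1}{2}k^3+2k^2+\tfrac{5}{2}k\right),$$ with equality if and only if $G\cong \overline{G}_{n,k}$.
   Context: All graphs are finite and simple. $d_G(u)$ denotes the degree of $u$ and $d_G(u,v)$ the distance between $u$ and $v$ in $G$. The reciprocal degree distance of a connected graph $G$ is $RDD(G)=\sum_{\{u,v\}\subseteq V(G)}\frac{d_G(u)+d_G(v)}{d_G(u,v)}$, the sum being over all unordered pairs of distinct vertices. A cut edge of a graph is an edge whose removal increases the number of components. (A connected graph of order $n$ has at most $n-1$ cut edges, so $k\le n-1$ here.) $\overline{G}_{n,k}$ denotes the graph of order $n$ obtained from the complete graph $K_{n-k}$ by attaching $k$ pendent vertices (new vertices of degree one) all to one and the same vertex of $K_{n-k}$. *)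

(* Defs.v *)
From mathcomp Require Import all_boot all_order all_algebra.

Set Implicit Arguments.
Unset Strict Implicit.
Unset Printing Implicit Defensive.

(* A graph on the finite vertex type T is given by its adjacency relation. *)

Definition simple_graph (T : finType) (e : rel T) : Prop :=
  symmetric e /\ irreflexive e.

Definition connected_graph (T : finType) (e : rel T) : Prop :=
  forall x y : T, connect e x y.

Definition deg (T : finType) (e : rel T) (x : T) : nat := #|[set y | e x y]|.

Definition has_walk (T : finType) (e : rel T) (m : nat) (x y : T) : bool :=
  [exists p : m.-tuple T, path e x p && (last x p == y)].

(* A shortest walk visits no vertex twice, so it has length < #|T|; the value
   is #|T| when x and y lie in different components. *)
Definition dist (T : finType) (e : rel T) (x y : T) : nat :=
  \big[minn/#|T|]_(m < #|T| | has_walk e m x y) m.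

Definition edges (T : finType) (e : rel T) : {set {set T}} :=
  [set A : {set T} | [exists x, exists y, e x y && (A == [set x; y])]].

Definition del_edge (T : finType) (e : rel T) (A : {set T}) : rel T :=
  [rel x y | e x y && ([set x; y] != A)].

Definition cut_edges (T : finType) (e : rel T) : {set {set T}} :=
  [set A in edges e | n_comp e T < n_comp (del_edge e A) T].

(* Comparing the ranks of the two vertices in the enumeration of T selects
   exactly one ordering of each unordered pair of distinct vertices. *)
Definition RDD (T : finType) (e : rel T) : rat :=
  (\sum_(p : T * T | (enum_rank p.1 < enum_rank p.2)%N)
     (deg e p.1 + deg e p.2)%N%:R / (dist e p.1 p.2)%:R)%R.

(* The vertices inl a form the complete graph on n - k vertices and the inr b
   are the k pendent vertices, all attached to the vertex inl 0.  Only k < n is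
   meaningful: n - k is truncated, and for k >= n there is no vertex inl 0. *)
Definition Gbar (n k : nat) : rel ('I_(n - k) + 'I_k) :=
  fun u v =>
    match u, v with
    | inl a, inl b => a != b
    | inl a, inr _ => val a == 0
    | inr _, inl b => val b == 0
    | inr _, inr _ => false
    end.

Arguments Gbar : clear implicits.

Definition graph_iso (T U : finType) (e : rel T) (e' : rel U) : Prop :=
  exists2 f : T -> U, bijective f & forall x y, e' (f x) (f y) = e x y.

(* Main.v *)
Require Import Defs.
From mathcomp Require Import all_boot all_order all_algebra.
From mathcomp Require Import zify ring lra fingraph.
Import Order.TTheory GRing.Theory Num.Theory.

Set Implicit Arguments.
Unset Strict Implicit.
Unset Printing Implicit Defensive.

(* Nonadjacent vertices are at distance at least 2, so, writing S and Q for the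
   sums of the degrees and of their squares, RDD <= ((n-1) S + Q) / 2, with
   equality iff the diameter is at most 2.  Removing the k cut edges leaves at
   least k+1 components; write a(x) for the remaining degrees and m = n - k.
   Every component has at most m vertices, hence the a(x) sum to at most
   m(m-1) and S <= m(m-1) + 2k.  A cut edge xy lies in no triangle, so
   d(x) + d(y) <= n, and it joins two different components, so
   a(x) + a(y) <= m-1; summing over the edges gives
   Q + k(m-1) <= kn + (m-1) S.  Together these two bounds are the theorem.
   In the equality case the diameter is at most 2, which forces every cut edge
   to be pendent at a universal vertex, and S = m(m-1) + 2k then makes the
   remaining m vertices a clique. *)

(** * Degree sums of a symmetric relation and its connected components *)

Section Graph.
Variable T : finType.
Implicit Types (e r : rel T) (x y u v : T).

Lemma degE e x : deg e x = \sum_y (e x y : nat).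
Proof.
rewrite /deg -sum1dep_card big_mkcond /=; apply: eq_bigr => y _; by case: (e x y).
Qed.

Lemma sum_mul_deg r (F : T -> nat) :
  \sum_x F x * deg r x = \sum_(p | r p.1 p.2) F p.1.
Proof.
rewrite -(pair_big_dep xpredT (fun x y => r x y) (fun x _ => F x)) /=.
apply: eq_bigr => x _; rewrite /deg -sum1dep_card big_distrr /=.
by apply: eq_bigr => y _; rewrite muln1.
Qed.

Lemma sum_pairC r (F : T -> nat) : symmetric r ->
  \sum_(p | r p.1 p.2) F p.2 = \sum_(p | r p.1 p.2) F p.1.
Proof.
move=> r_sym; rewrite (reindex_inj (h := fun p : T * T => (p.2, p.1))) /=.
  by apply: eq_bigl => p; rewrite r_sym.
by move=> [a b] [c d] [-> ->].
Qed.

(** The right side runs over ordered pairs, so each edge is counted twice; swapping the two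
    coordinates shows that both halves agree. *)
Lemma handshake r (F : T -> nat) : symmetric r ->
  2 * (\sum_x F x * deg r x) = \sum_(p | r p.1 p.2) (F p.1 + F p.2).
Proof.
by move=> r_sym; rewrite big_split /= (sum_pairC _ r_sym) sum_mul_deg mul2n addnn.
Qed.

Lemma deg_le_pred e x : irreflexive e -> deg e x <= #|T|.-1.
Proof.
move=> e_irr; rewrite /deg.
have -> : #|T|.-1 = #|[set~ x]| by rewrite cardsC1.
apply/subset_leq_card/subsetP => y; rewrite !inE => exy.
by apply: contraTneq exy => ->; rewrite e_irr.
Qed.

Lemma deg_eq_pred e x y : irreflexive e -> deg e x = #|T|.-1 ->
  x != y -> e x y.
Proof.
move=> e_irr dx xy.
have sub : [set y | e x y] \subset [set~ x].
  by apply/subsetP => z; rewrite !inE => exz; apply: contraTneq exz => ->; rewrite e_irr.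
have /eqP E : [set y | e x y] == [set~ x].
  by rewrite eqEcard sub cardsC1 -/(deg e x) dx leqnn.
by have : y \in [set~ x]; [rewrite !inE eq_sym | rewrite -E inE].
Qed.

(** Each class of [e] is a union of classes of [r], so [root e] maps the roots of [r] onto those of
    [e]. It stays onto without [root r u], whose image is also reached from the different root
    [root r v]. *)
Lemma ltn_n_comp e r u v : symmetric e -> symmetric r -> subrel r e ->
  connect e u v -> ~~ connect r u v -> n_comp e T < n_comp r T.
Proof.
move=> e_sym r_sym sub_re cuv nuv.
have eC := sym_connect_sym e_sym; have rC := sym_connect_sym r_sym.
have sub : subrel (connect r) (connect e).
  by apply: connect_sub => x y /sub_re /connect1.
pose A := [set x in roots e]; pose B := [set x in roots r].
have rootB x : root r x \in B by rewrite inE; exact: roots_root.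
have sur : A \subset root e @: (B :\ root r u).
  apply/subsetP => x; rewrite inE => /eqP rx; apply/imsetP.
  have ex y : root r y = root r x -> root e y = x.
    move=> E; rewrite -[RHS]rx; apply/eqP; rewrite root_connect //.
    by apply: sub; rewrite -root_connect // E.
  have rK y : root r (root r y) = root r y by rewrite root_root.
  have [E|ne] := eqVneq (root r x) (root r u).
    exists (root r v); last first.
      have -> : root e (root r v) = root e v.
        by apply/eqP; rewrite root_connect // eC; apply: sub; apply: connect_root.
      have -> : root e v = root e u by apply/esym/eqP; rewrite root_connect.
      by rewrite ex.
    by rewrite in_setD1 rootB andbT eq_sym root_connect.
  exists (root r x); last by rewrite ex.
  by rewrite in_setD1 ne rootB.
have := leq_trans (subset_leq_card sur) (leq_imset_card _ _).
have -> : n_comp e T = #|A| by apply: eq_card => x; rewrite !inE andbT.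
have -> : n_comp r T = #|B| by apply: eq_card => x; rewrite !inE andbT.
by rewrite (cardsD1 (root r u) B) rootB add1n ltnS.
Qed.

Lemma sum_component r : symmetric r -> 
  forall F : T -> nat, \sum_x F (root r x) = \sum_(z in roots r) F z * #|connect r z|.
Proof.
move=> r_sym F; have rC := sym_connect_sym r_sym.
rewrite (partition_big (root r) (mem (roots r))) /=; last first.
  by move=> x _; exact: roots_root.
apply: eq_bigr => z /eqP rz.
rewrite -sum1_card big_distrr /=.
apply: eq_big => [x|x /eqP->]; last by rewrite muln1.
by rewrite -[in RHS]topredE /= -root_connect // rz eq_sym.
Qed.

Lemma card_components r : symmetric r ->
  #|T| = \sum_(z in roots r) #|connect r z|.
Proof.
move=> r_sym; rewrite -sum1_card (sum_component r_sym (fun=> 1)).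
by apply: eq_bigr => z _; rewrite mul1n.
Qed.

Lemma card_component_gt0 r x : 0 < #|connect r x|.
Proof. by apply/card_gt0P; exists x; rewrite -topredE /= connect0. Qed.

Lemma card_component_root r x : symmetric r -> #|connect r (root r x)| = #|connect r x|.
Proof.
move=> r_sym; have rC := sym_connect_sym r_sym.
apply: eq_card => y; rewrite -!topredE /=; apply/esym.
by apply: same_connect => //; apply: connect_root.
Qed.

Lemma n_compE r : n_comp r T = #|roots r|.
Proof. by apply: eq_card => x; rewrite !inE andbT. Qed.

(** With sizes lowered by one all terms stay nonnegative, so bounds on one or two components follow
    by dropping the other terms. *)
Lemma sum_component_pred r : symmetric r ->
  \sum_(z in roots r) #|connect r z|.-1 + n_comp r T = #|T|.
Proof.
move=> r_sym; rewrite n_compE (card_components r_sym) -sum1_card -big_split /=.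
by apply: eq_bigr => z _; have := card_component_gt0 r z; lia.
Qed.

Lemma card_component_le r x : symmetric r ->
  #|connect r x| + n_comp r T <= #|T|.+1.
Proof.
move=> r_sym; have rC := sym_connect_sym r_sym.
have := sum_component_pred r_sym; have := card_component_gt0 r x.
rewrite (bigD1 (root r x) (roots_root rC x)) /= card_component_root //.
lia.
Qed.

Lemma card_component2_le r x y : symmetric r -> ~~ connect r x y ->
  #|connect r x| + #|connect r y| + n_comp r T <= #|T|.+2.
Proof.
move=> r_sym nxy; have rC := sym_connect_sym r_sym.
have ry : (root r y \in roots r) && (root r y != root r x).
  by rewrite [root r y \in _](roots_root rC) eq_sym root_connect.
have := sum_component_pred r_sym.
have := card_component_gt0 r x; have := card_component_gt0 r y.
rewrite (bigD1 (root r x) (roots_root rC x)) /= (bigD1 (root r y) ry) /=.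
rewrite !card_component_root //; lia.
Qed.

Lemma deg_lt_component r x : irreflexive r -> deg r x < #|connect r x|.
Proof.
move=> r_irr; rewrite /deg [X in _ < X](cardD1 x).
rewrite -[x \in _]topredE /= connect0 add1n ltnS.
apply/subset_leq_card/subsetP => y; rewrite !inE => rxy.
by rewrite connect1 // andbT; apply: contraTneq rxy => ->; rewrite r_irr.
Qed.

(** A component with c vertices has degree sum at most c(c-1). Here c <= m, and the numbers c-1 add
    up to at most m-1. *)
Lemma sum_deg_components r m : symmetric r -> irreflexive r ->
  #|T| < m + n_comp r T -> \sum_x deg r x <= m * m.-1.
Proof.
move=> r_sym r_irr cm; have rC := sym_connect_sym r_sym.
have le1 : \sum_x deg r x <= \sum_x (#|connect r (root r x)|.-1).
  apply: leq_sum => x _; rewrite card_component_root //.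
  by have := deg_lt_component x r_irr; lia.
apply: (leq_trans le1).
rewrite (sum_component r_sym (fun z => #|connect r z|.-1)).
have : \sum_(z in roots r) #|connect r z|.-1 * #|connect r z|
    <= \sum_(z in roots r) #|connect r z|.-1 * m.
  apply: leq_sum => z _; rewrite leq_mul2l; apply/orP; right.
  by have := card_component_le z r_sym; lia.
move=> /leq_trans; apply; rewrite -big_distrl /= mulnC leq_mul2l; apply/orP; right.
have := sum_component_pred r_sym; lia.
Qed.

End Graph.

(** * Cut edges, and the number of components after deleting them *)

Section CutEdges.
Variable T : finType.
Implicit Types (x y u v : T) (e : rel T) (A : {set {set T}}).

Definition keep_edges e A : rel T := [rel x y | e x y && ([set x; y] \notin A)].
Definition cut_rel e : rel T := [rel x y | e x y && ([set x; y] \in cut_edges e)].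
Definition noncut_rel e : rel T := keep_edges e (cut_edges e).

Lemma eq_set2 u v x y : [set u; v] = [set x; y] ->
  (u = x /\ v = y) \/ (u = y /\ v = x).
Proof.
move=> E.
have : u \in [set x; y] by rewrite -E set21.
have : v \in [set x; y] by rewrite -E set22.
have : x \in [set u; v] by rewrite E set21.
have : y \in [set u; v] by rewrite E set22.
by rewrite !inE => /orP[]/eqP ? /orP[]/eqP ? /orP[]/eqP ? /orP[]/eqP ?; subst; auto.
Qed.

Lemma del_edge_sym e E : symmetric e -> symmetric (del_edge e E).
Proof. by move=> e_sym x y; rewrite /del_edge /cut_rel /keep_edges /= e_sym setUC. Qed.

Lemma keep_edges_sym e A : symmetric e -> symmetric (keep_edges e A).
Proof. by move=> e_sym x y; rewrite /del_edge /cut_rel /keep_edges /= e_sym setUC. Qed.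

Lemma cut_rel_sym e : symmetric e -> symmetric (cut_rel e).
Proof. by move=> e_sym x y; rewrite /del_edge /cut_rel /keep_edges /= e_sym setUC. Qed.

Lemma noncut_rel_irr e : irreflexive e -> irreflexive (noncut_rel e).
Proof. by move=> e_irr x; rewrite /noncut_rel /keep_edges /= e_irr. Qed.

(** If the ends stayed connected, deleting the edge would not change the connectivity relation,
    hence not the number of components. *)
Lemma cut_edge_disconnects e x y : symmetric e -> [set x; y] \in cut_edges e ->
  ~~ connect (del_edge e [set x; y]) x y.
Proof.
move=> e_sym; rewrite inE => /andP[_]; apply: contraL => cxy; rewrite -leqNgt.
have dC := sym_connect_sym (del_edge_sym [set x; y] e_sym).
rewrite (eq_n_comp (e' := del_edge e [set x; y])) // => u v.
apply/idP/idP; apply: connect_sub => a b; last by case/andP=> ab _; exact: connect1.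
move=> ab; have [/eq_set2 |ne] := eqVneq [set a; b] [set x; y].
  by case=> -[-> ->] //; rewrite dC.
by apply: connect1; rewrite /del_edge /= ab.
Qed.

Lemma cut_rel_bypass e r x y : symmetric e -> cut_rel e x y ->
  subrel r (del_edge e [set x; y]) -> ~~ connect r x y.
Proof.
move=> e_sym /andP[exy /(cut_edge_disconnects e_sym)] ncxy sub; apply: contra ncxy.
by apply: connect_sub => a b /sub; exact: connect1.
Qed.

Lemma cut_edge_repr e E : E \in cut_edges e ->
  exists x y, [/\ E = [set x; y], e x y & cut_rel e x y].
Proof.
move=> cE; have := cE; rewrite inE => /andP[+ _].
rewrite inE => /existsP[x /existsP[y /andP[exy /eqP EE]]].
by exists x, y; split=> //; rewrite /cut_rel /= exy -EE.
Qed.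

(** Induction on the size of [A]: deleting one more edge [E] after those of [A :\ E] splits a
    component, since nothing in [e] that avoids the cut edge [E] can connect its ends. *)
Lemma card_cut_edges_n_comp e A : symmetric e -> A \subset cut_edges e ->
  #|A| + n_comp e T <= n_comp (keep_edges e A) T.
Proof.
move=> e_sym; have [m] := ubnP #|A|; elim: m A => // m IH A leA subA.
have [->|[E EA]] := set_0Vmem A.
  rewrite cards0 add0n (eq_n_comp (e' := keep_edges e set0)) //.
  by apply: eq_connect => x y; rewrite /keep_edges /= inE andbT.
have leA' : #|A :\ E| < m by move: leA; rewrite (cardsD1 E) EA.
have := IH _ leA' (subset_trans (subsetDl _ _) subA).
rewrite [in X in _ -> X](cardsD1 E) EA => /leq_ltn_trans; apply.
have [x [y [EE exy cxy]]] := cut_edge_repr (subsetP subA _ EA).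
apply: (@ltn_n_comp _ _ _ x y); rewrite ?keep_edges_sym //.
- by apply: keep_edges_sym.
- by apply: keep_edges_sym.
- move=> a b; rewrite /keep_edges /= => /andP[->]; apply: contra.
  by rewrite !inE => /andP[].
- by apply: connect1; rewrite /keep_edges /= exy -EE !inE eqxx.
apply: (cut_rel_bypass e_sym cxy) => a b.
rewrite /keep_edges /del_edge /= => /andP[-> nA] /=.
by apply: contraNneq nA => ->; rewrite -EE.
Qed.

(** The fibre over a cut edge consists of its two orderings, which differ because there are no
    loops. *)
Lemma card_cut_rel e : symmetric e -> irreflexive e ->
  \sum_(p | cut_rel e p.1 p.2) 1 = 2 * #|cut_edges e|.
Proof.
move=> e_sym e_irr.
rewrite (partition_big (fun p => [set p.1; p.2]) (mem (cut_edges e))) /=; last first.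
  by case=> x y /andP[].
rewrite mulnC -sum_nat_const; apply: eq_bigr => E cE.
have [x [y [EE exy cxy]]] := cut_edge_repr cE.
have xy : (x, y) != (y, x).
  by apply: contraTneq exy => -[-> _]; rewrite e_irr.
rewrite sum1dep_card -[RHS](_ : #|[set (x, y); (y, x)]| = 2); last by rewrite cards2 xy.
apply: eq_card => -[u v]; rewrite !inE /=; apply/idP/idP.
  by rewrite EE => /andP[_ /eqP /eq_set2 [] [-> ->]]; rewrite eqxx ?orbT.
case/orP=> /eqP[-> ->]; rewrite /cut_rel /=.
  by rewrite exy -EE eqxx cE.
by rewrite [e y x]e_sym [[set y; x]]setUC exy -EE eqxx cE.
Qed.
End CutEdges.

(** * Upper bounds for the sums of the degrees and of their squares *)

Section DegreeBounds.
Variables (T : finType) (e : rel T).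
Hypotheses (e_sym : symmetric e) (e_irr : irreflexive e).
Implicit Types x y z : T.

Local Notation n := #|T|.
Local Notation k := #|cut_edges e|.

Lemma edge_neq x y : e x y -> x != y.
Proof. by apply: contraTneq => ->; rewrite e_irr. Qed.

(** A step with an end outside {x, y} uses a different edge; detours around a cut edge are assembled
    from such steps. *)
Lemma del_edge_path x y u w : e u w -> (u != x) && (u != y) || (w != x) && (w != y) ->
  connect (del_edge e [set x; y]) u w.
Proof.
move=> euw H; apply: connect1; rewrite /del_edge /= euw /=.
by apply: contraTneq H => /eq_set2 [] [-> ->]; rewrite !eqxx ?andbF.
Qed.

Lemma cut_rel_no_common_neighbour x y z : cut_rel e x y -> e x z -> ~~ e y z.
Proof.
move=> cxy exz; apply/negP => eyz.
have := cut_rel_bypass e_sym cxy (fun _ _ => id).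
have zx : z != x by rewrite eq_sym edge_neq.
have zy : z != y by rewrite eq_sym edge_neq.
case/negP; apply: (@connect_trans _ _ z); apply: del_edge_path; rewrite ?zx ?zy ?orbT //.
by rewrite e_sym.
Qed.

Lemma cut_rel_deg x y : cut_rel e x y -> deg e x + deg e y <= n.
Proof.
move=> cxy; rewrite /deg -cardsUI.
have -> : [set z | e x z] :&: [set z | e y z] = set0.
  apply/setP => z; rewrite !inE; apply/negP => /andP[exz].
  by apply/negP/(cut_rel_no_common_neighbour cxy).
by rewrite cards0 addn0 max_card.
Qed.

Lemma noncut_rel_sym : symmetric (noncut_rel e).
Proof. exact: keep_edges_sym. Qed.

Lemma degD x : deg e x = deg (noncut_rel e) x + deg (cut_rel e) x.
Proof.
rewrite !degE -big_split /=; apply: eq_bigr => y _.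
rewrite /noncut_rel /cut_rel /keep_edges /=.
by case: (e x y) => //=; case: (_ \in _).
Qed.

Lemma sum_deg_cut_rel : \sum_x deg (cut_rel e) x = 2 * k.
Proof.
rewrite -card_cut_rel // -(sum_mul_deg (cut_rel e) (fun=> 1)).
by apply: eq_bigr => x _; rewrite mul1n.
Qed.

(** Double counting: the left side adds [F] over both ends of every cut edge. *)
Lemma sum_cut_rel_le (F : T -> nat) b :
  (forall x y, cut_rel e x y -> F x + F y <= b) ->
  \sum_x F x * deg (cut_rel e) x <= k * b.
Proof.
move=> Fb; rewrite -(leq_pmul2l (isT : 0 < 2)) handshake; last exact: cut_rel_sym.
rewrite mulnA -card_cut_rel // big_distrl /=.
by apply: leq_sum => p cp; rewrite mul1n Fb.
Qed.

Hypothesis n_gt0 : 0 < n.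

Lemma n_comp_noncut_rel : k < n_comp (noncut_rel e) T.
Proof.
have := card_cut_edges_n_comp e_sym (subxx (cut_edges e)).
apply: leq_trans; rewrite -addn1 leq_add2l n_compE.
have [x _] := card_gt0P n_gt0; apply/card_gt0P; exists (root e x).
exact: (roots_root (sym_connect_sym e_sym)).
Qed.

Lemma card_cut_edges_lt : k < n.
Proof. by apply: leq_trans n_comp_noncut_rel _; rewrite n_compE max_card. Qed.

Lemma noncut_rel_deg x : deg (noncut_rel e) x <= (n - k).-1.
Proof.
have := deg_lt_component x (noncut_rel_irr e_irr).
have := card_component_le x noncut_rel_sym; have := n_comp_noncut_rel; lia.
Qed.

(** The ends lie in different components, which together have at most n + 2 - (k + 1) vertices; each
    degree is smaller than the size of its component, which saves another 2. *)
Lemma cut_rel_noncut_deg x y : cut_rel e x y ->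
  deg (noncut_rel e) x + deg (noncut_rel e) y <= (n - k).-1.
Proof.
move=> cxy.
have nxy : ~~ connect (noncut_rel e) x y.
  apply: (cut_rel_bypass e_sym cxy) => a b; rewrite /noncut_rel /keep_edges /del_edge /=.
  by case/andP=> -> /=; apply: contraNneq => ->; case/andP: cxy.
have := card_component2_le noncut_rel_sym nxy; have := n_comp_noncut_rel.
have := deg_lt_component x (noncut_rel_irr e_irr).
have := deg_lt_component y (noncut_rel_irr e_irr).
lia.
Qed.

Lemma sum_deg_le : \sum_x deg e x <= (n - k) * (n - k).-1 + 2 * k.
Proof.
under eq_bigr do rewrite degD; rewrite big_split /= sum_deg_cut_rel leq_add2r.
apply: sum_deg_components; [exact: noncut_rel_sym | exact: noncut_rel_irr | ].
by rewrite -{1}(subnK (ltnW card_cut_edges_lt)) ltn_add2l n_comp_noncut_rel.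
Qed.

(** Write d = a + c with a the noncut and c the cut degree, so that d^2 = a^2 + ac + dc. The three
    sums are at most (m-1) times the sum of a, k(m-1) and kn, where m = n - k, and the sum of a is
    that of d minus 2k. *)
Lemma sum_sqr_deg_le :
  \sum_x deg e x ^ 2 + k * (n - k).-1 <= k * n + (n - k).-1 * \sum_x deg e x.
Proof.
have dc := sum_cut_rel_le cut_rel_deg.
have ac := sum_cut_rel_le cut_rel_noncut_deg.
have aa : \sum_x deg (noncut_rel e) x ^ 2 <= (n - k).-1 * \sum_x deg (noncut_rel e) x.
  rewrite big_distrr /=; apply: leq_sum => x _.
  by rewrite -mulnn leq_mul2r noncut_rel_deg orbT.
have Ed : \sum_x deg e x = \sum_x deg (noncut_rel e) x + 2 * k.
  by under eq_bigr do rewrite degD; rewrite big_split /= sum_deg_cut_rel.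
have -> : \sum_x deg e x ^ 2 = \sum_x deg (noncut_rel e) x ^ 2
    + \sum_x deg (noncut_rel e) x * deg (cut_rel e) x + \sum_x deg e x * deg (cut_rel e) x.
  by rewrite -!big_split /=; apply: eq_bigr => x _; rewrite degD; nia.
rewrite Ed mulnDr; lia.
Qed.

End DegreeBounds.

(** * Distances one and two in a connected graph *)

Section Distance.
Variables (T : finType) (e : rel T).
Hypotheses (e_irr : irreflexive e) (e_conn : connected_graph e).
Implicit Types x y z : T.

Lemma has_walkP m x y :
  reflect (exists p, [/\ size p = m, path e x p & last x p = y]) (has_walk e m x y).
Proof.
apply: (iffP existsP) => [[p /andP[xp /eqP lp]]|[p [sp xp lp]]].
  by exists p; rewrite size_tuple.
have szp : size p == m by rewrite sp.
by exists (Tuple szp); rewrite xp lp eqxx.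
Qed.

Lemma has_walk0 x y : has_walk e 0 x y = (x == y).
Proof.
by apply/has_walkP/eqP => [[[|z p] [//]]|->]; exists [::].
Qed.

Lemma has_walk1 x y : has_walk e 1 x y = e x y.
Proof.
apply/has_walkP/idP => [[[|z[|? ?]] [] //= _ + <-]|exy]; first by rewrite andbT.
by exists [:: y]; rewrite /= exy.
Qed.

Lemma has_walk2P x y : reflect (exists z, e x z && e z y) (has_walk e 2 x y).
Proof.
apply: (iffP (has_walkP _ _ _)) => [[[|z[|w[|? ?]]] [] //= _ + <-]|[z xzy]].
  by rewrite andbT => ?; exists z.
by exists [:: z; y]; rewrite /= andbT.
Qed.

Lemma dist_le m x y : has_walk e m x y -> m < #|T| -> dist e x y <= m.
Proof.
move=> wm lt; rewrite /dist -minEnat.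
exact: (@bigmin_le_cond _ nat _ _ (Ordinal lt)
  (fun i : 'I_#|T| => has_walk e i x y) (fun i => i : nat) wm).
Qed.

Lemma has_walk_dist x y : has_walk e (dist e x y) x y.
Proof.
have : dist e x y < #|T|.
  have /connectP[p ep ->] := e_conn x y.
  case/shortenP: ep => p' ep' up' _.
  have lt : size p' < #|T| by have := max_card (mem (x :: p')); rewrite (card_uniqP up').
  apply: leq_ltn_trans (lt); apply: dist_le (lt).
  by apply/has_walkP; exists p'.
(* The bound just proved stays a premise of the induction predicate, which excludes the default
   value [#|T|] of the minimum. *)
rewrite /dist; elim/big_ind: _ => [|a b Ha Hb|//]; first by rewrite ltnn.
by rewrite /minn; case: ifP.
Qed.

Lemma dist_gt0 x y : x != y -> 0 < dist e x y.
Proof.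
rewrite lt0n; apply: contraNneq => d0.
by have := has_walk_dist x y; rewrite d0 has_walk0.
Qed.

Lemma dist_adj x y : e x y -> dist e x y = 1.
Proof.
move=> exy; have xy : x != y by apply: contraTneq exy => ->; rewrite e_irr.
apply/eqP; rewrite eqn_leq dist_gt0 // dist_le ?has_walk1 //.
have u2 : uniq [:: x; y] by rewrite /= inE xy.
by have := max_card (mem [:: x; y]); rewrite (card_uniqP u2).
Qed.

Lemma dist_nonadj x y : x != y -> ~~ e x y -> 1 < dist e x y.
Proof.
move=> xy nxy; rewrite ltn_neqAle dist_gt0 // andbT.
by apply: contraNneq nxy => d1; have := has_walk_dist x y; rewrite -d1 has_walk1.
Qed.

Lemma dist_eq2P x y : x != y -> ~~ e x y ->
  reflect (exists z, e x z && e z y) (dist e x y == 2).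
Proof.
move=> xy nxy; apply: (iffP eqP) => [d2|/[dup] xzy [z /andP[xz zy]]].
  by apply/has_walk2P; rewrite -d2 has_walk_dist.
apply/eqP; rewrite eqn_leq dist_nonadj // andbT dist_le //; first exact/has_walk2P.
have xz' : x != z by apply: contraTneq xz => ->; rewrite e_irr.
have yz' : y != z by apply: contraTneq zy => ->; rewrite e_irr.
(* The minimum in [dist] ranges only over lengths below [#|T|], so length 2 requires three distinct
   vertices. *)
have u3 : uniq [:: x; y; z] by rewrite /= !inE negb_or xy xz' yz'.
by have := max_card (mem [:: x; y; z]); rewrite (card_uniqP u3).
Qed.

Lemma deg_gt0 x y : x != y -> 0 < deg e x.
Proof.
move=> xy; have /connectP[[|z p] /= ep yp] := e_conn x y.
  by rewrite yp eqxx in xy.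
by apply/card_gt0P; exists z; rewrite inE; case/andP: ep.
Qed.

End Distance.

(** The left side is the total degree split into k leaves, the hub and the degree sum [s] of the
    other vertices; there are n - k - 1 of these. *)
Lemma clique_degree_arith n k s : k < n ->
  k + (n.-1 + s) = (n - k) * (n - k).-1 + 2 * k -> s = (n - k).-1 * (n - k).-1.
Proof.
move=> kn; have -> : n = k + (n - k) by lia.
by rewrite addKn; case: (n - k) (subn_gt0 k n) => [|m] /=; [lia | nia].
Qed.

(** * Structure of a graph of diameter at most two with the largest degree sum *)

Section Extremal.
Variables (T : finType) (e : rel T).
Hypotheses (e_sym : symmetric e) (e_irr : irreflexive e).
Implicit Types x y z : T.
Local Notation n := #|T|.
Local Notation k := #|cut_edges e|.
Hypothesis n_gt0 : 0 < n.
Hypothesis diam2 : forall x y, x != y -> ~~ e x y -> exists z, e x z && e z y.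
Hypothesis sum_deg : \sum_x deg e x = (n - k) * (n - k).-1 + 2 * k.

(** Otherwise x has a further neighbour [u] and y a further neighbour [w]. These are within distance
    2, and as a cut edge lies in no triangle, a shortest route from [u] to [w] avoids x and y,
    giving a detour around the edge. *)
Lemma cut_rel_leaf x y : cut_rel e x y ->
  (forall z, e x z -> z = y) \/ (forall z, e y z -> z = x).
Proof.
move=> cxy; have exy : e x y by case/andP: cxy.
have [/existsP[u /andP[xu uy]]|/existsPn nu] :=
  boolP [exists u, e x u && (u != y)]; last first.
  by left=> z xz; apply/eqP; have := nu z; rewrite xz /= negbK.
have [/existsP[w /andP[yw wx]]|/existsPn nw] :=
  boolP [exists w, e y w && (w != x)]; last first.
  by right=> z yz; apply/eqP; have := nw z; rewrite yz /= negbK.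
have nxw : ~~ e x w 
  by apply: contraTN yw; exact: cut_rel_no_common_neighbour.
have nyu : ~~ e y u := cut_rel_no_common_neighbour e_sym e_irr cxy xu.
case/negP: (cut_rel_bypass e_sym cxy (fun _ _ => id)).
have ux : u != x by rewrite eq_sym (edge_neq e_irr).
have wy : w != y by rewrite eq_sym (edge_neq e_irr).
have uw : u != w by apply: contraNneq nxw => <-.
apply: (@connect_trans _ _ u); first by apply: del_edge_path => //; rewrite ux uy orbT.
apply: (@connect_trans _ _ w); last first.
  by apply: del_edge_path; rewrite 1?e_sym // wx wy.
have [euw|neuw] := boolP (e u w); first by apply: del_edge_path => //; rewrite ux uy.
have [z /andP[uz zw]] := diam2 uw neuw.
have zx : z != x by apply: contraTneq zw => ->.
have zy : z != y by apply: contraTneq uz => ->; rewrite e_sym.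
by apply: (@connect_trans _ _ z); apply: del_edge_path => //; rewrite zx zy ?orbT.
Qed.

Lemma universal_vertex : exists v, forall x, x != v -> e v x.
Proof.
have [k0|[E cE]] := set_0Vmem (cut_edges e).
  (* Without cut edges the degree sum is n(n-1), so every vertex has degree n-1 and any vertex will
     do. *)
  have [v _] := card_gt0P n_gt0; exists v => x xv.
  have le z : true -> deg e z <= n.-1 ?= iff (deg e z == n.-1).
    by move=> _; split=> //; exact: deg_le_pred.
  have := leqif_sum le; rewrite sum_deg k0 cards0 muln0 addn0 subn0 sum_nat_const => -[_].
  rewrite eqxx => /esym/forallP/(_ v) /= /eqP dv.
  by apply: deg_eq_pred; rewrite // eq_sym.
(* Every vertex is within distance 2 of the leaf [y], and the only way out of [y] leads through
   [x]. *)
have leaf x y : e x y -> (forall z, e y z -> z = x) -> forall z, z != x -> e x z.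
  move=> exy Hy z zx; have [->|zy] := eqVneq z y; first by [].
  have nyz : ~~ e y z by apply: contraNN zx => /Hy ->.
  rewrite eq_sym in zy; have [w /andP[/Hy -> //]] := diam2 zy nyz.
have [x [y [_ exy cxy]]] := cut_edge_repr cE.
case: (cut_rel_leaf cxy) => H; [exists y | exists x]; apply: leaf H => //.
by rewrite e_sym.
Qed.

(** A universal vertex [v] serves as hub, [P] collects the other ends of its cut edges and becomes
    the set of leaves, and [Q] together with [v] becomes the clique. *)
Lemma graph_iso_Gbar : graph_iso e (Gbar n k).
Proof.
have [v uv] := universal_vertex.
have vu x : x != v -> e x v by rewrite e_sym; exact: uv.
have kn := card_cut_edges_lt e_sym n_gt0.
pose P := [set w | cut_rel e v w].
have Pv : v \notin P by rewrite inE /cut_rel /= e_irr.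
have leafP w z : w \in P -> e w z -> z = v.
  rewrite inE => cvw ewz; apply/eqP; apply: contraTT ewz => zv.
  exact: (cut_rel_no_common_neighbour e_sym e_irr cvw (uv _ zv)).
have cardP : #|P| = k.
  rewrite -(card_imset P (f := fun w => [set v; w])); last first.
    by move=> a b /eq_set2 [] [] // -> ->.
  apply: eq_card => E; apply/imsetP/idP => [[w]|cE].
    by rewrite inE => /andP[_ cE] ->.
  have [x [y [EE exy cxy]]] := cut_edge_repr cE.
  have [xv|xv] := eqVneq x v; first by exists y; rewrite ?inE -xv.
  have [yv|yv] := eqVneq y v; first exists x.
  - by rewrite inE -yv cut_rel_sym.
  - by rewrite EE yv setUC.
  (* A cut edge avoiding [v] would form a triangle with it. *)
  by have := cut_rel_no_common_neighbour e_sym e_irr cxy (vu _ xv); rewrite vu.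
have degP w : w \in P -> deg e w = 1.
  move=> wP; rewrite /deg (_ : [set y | e w y] = [set v]) ?cards1 //.
  apply/setP => z; rewrite !inE; apply/idP/eqP => [|->]; first exact: leafP.
  by apply: vu; apply: contraNneq Pv => <-.
pose Q := ~: P :\ v.
have cardQ : #|Q| = (n - k).-1.
  by have := cardsD1 v (~: P); rewrite inE Pv cardsCs setCK cardP => ->.
have NQ x : x \in Q -> [set y | e x y] \subset ~: P :\ x.
  rewrite !inE => /andP[xv _]; apply/subsetP => y; rewrite !in_setD1 in_setC inE => exy.
  rewrite eq_sym (edge_neq e_irr) //=; apply: contraNN xv => yP.
  by apply/eqP; apply: (leafP y); rewrite // e_sym.
have cardNQ x : x \in Q -> #|~: P :\ x| = (n - k).-1.
  rewrite !inE => /andP[_ xP].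
  by have := cardsD1 x (~: P); rewrite !inE xP cardsCs setCK cardP => ->.
have degQ x : x \in Q -> deg e x <= (n - k).-1 ?= iff (deg e x == (n - k).-1).
  by move=> xQ; split=> //; rewrite -(cardNQ x) // subset_leq_card ?NQ.
have degv : deg e v = n.-1.
  apply/eqP; rewrite eqn_leq deg_le_pred //= -(cardsC1 v) subset_leq_card //.
  by apply/subsetP => y; rewrite !inE; exact: uv.
(* After subtracting the leaves and the hub, the prescribed total makes the degree bound on [Q]
   tight in sum, hence at every vertex. *)
have {}degQ x : x \in Q -> deg e x = (n - k).-1.
  have [_] := leqif_sum degQ.
  have -> : \sum_(i in Q) deg e i = \sum_(i in Q) (n - k).-1.
    move: sum_deg; rewrite (bigID (mem P)) /= (eq_bigr (fun=> 1)) //.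
    rewrite sum_nat_const muln1 cardP.
    rewrite (bigD1 v) //= degv.
    rewrite (eq_bigl (mem Q)); last by move=> z; rewrite !inE andbC.
    rewrite [in X in _ -> X]sum_nat_const cardQ; exact: clique_degree_arith.
  by rewrite eqxx => /esym/forall_inP H /H /eqP.
have adjQ x y : x \in Q -> y \notin P -> x != y -> e x y.
  move=> xQ yP xy.
  have /eqP E : [set y | e x y] == ~: P :\ x.
    by rewrite eqEcard NQ //= cardNQ // -/(deg e x) degQ.
  by have : y \in ~: P :\ x; [rewrite in_setD1 eq_sym xy in_setC | rewrite -E inE].
(* The hub comes first so that it receives index 0, as in [Gbar]. *)
pose s := v :: enum Q; pose t := enum P.
have sz_s : size s = n - k by rewrite /= -cardE cardQ prednK // subn_gt0.
have sz_t : size t = k by rewrite -cardE.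
have us : uniq s by rewrite /= enum_uniq mem_enum !inE eqxx.
have ut : uniq t := enum_uniq _.
have sP x : x \in s -> x \notin P.
  by rewrite inE => /orP[/eqP -> //|]; rewrite mem_enum !inE => /andP[].
pose g (u : 'I_(n - k) + 'I_k) : T :=
  match u with inl a => nth v s a | inr b => nth v t b end.
have gl a : g (inl a) \in s by rewrite mem_nth // sz_s.
have gr b : g (inr b) \in P by rewrite -mem_enum mem_nth // sz_t.
have gll a b : (g (inl a) == g (inl b)) = (a == b) by rewrite /g nth_uniq ?sz_s.
have grr a b : (g (inr a) == g (inr b)) = (a == b) by rewrite /g nth_uniq ?sz_t.
have glr a b : g (inl a) != g (inr b).
  by apply: contraNneq (sP _ (gl a)) => ->.
have gv a : (g (inl a) == v) = (val a == 0).
  by rewrite (_ : v = nth v s 0) // nth_uniq ?sz_s // subn_gt0.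
have [f fK gK] : bijective g.
  apply: inj_card_bij; last by rewrite card_sum !card_ord; lia.
  move=> [a|a] [b|b] /eqP; rewrite ?gll ?grr; first by move/eqP->.
  - by rewrite (negPf (glr _ _)).
  - by rewrite eq_sym (negPf (glr _ _)).
  - by move/eqP->.
exists f; first by exists g.
suff main u w : Gbar n k u w = e (g u) (g w) by move=> x y; rewrite main !gK.
have lr a b : e (g (inl a)) (g (inr b)) = (val a == 0).
  rewrite -gv; apply/idP/eqP => [|->]; first by rewrite e_sym; apply: leafP.
  by apply: uv; apply: contraNneq Pv => <-.
case: u w => [a|a] [b|b] /=.
- rewrite -gll; apply/idP/idP => [ab|]; last exact: edge_neq.
  have := gl a; rewrite inE mem_enum => /orP[/eqP av|aQ].
    have bv : g (inl b) != v by rewrite eq_sym -av.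
    by rewrite -[nth _ _ a]/(g (inl a)) av; exact: uv bv.
  exact: (adjQ (g (inl a)) (g (inl b)) aQ (sP _ (gl b)) ab).
- by have := lr a b.
- by have := lr b a; rewrite e_sym.
- apply/esym/negbTE/negP => /(leafP _ _ (gr a)) E; by move: Pv; rewrite -E gr.
Qed.

End Extremal.

(** * Degrees and diameter of the extremal graph *)

Section GbarDegrees.
Variables n k : nat.
Hypothesis kn : k < n.
Local Notation m := (n - k).

Lemma sum_ord_val0 p (F : bool -> nat) : 0 < p ->
  \sum_(b < p) F (val b == 0) = F true + p.-1 * F false.
Proof.
case: p => // p _; rewrite big_ord_recl /=; congr (_ + _).
by rewrite -[in RHS](card_ord p) -sum_nat_const.
Qed.

Lemma deg_Gbar (u : 'I_m + 'I_k) : deg (Gbar n k) u =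
  match u with inl a => if val a == 0 then n.-1 else m.-1 | inr _ => 1 end.
Proof.
have m_gt0 : 0 < m by rewrite subn_gt0.
rewrite degE big_sumType /=; case: u => [a|a].
  rewrite sum_nat_const card_ord.
  have -> : \sum_(b < m) ((a != b) : nat) = m.-1.
    have := cardsC1 a; rewrite card_ord => <-; rewrite -sum1_card [RHS]big_mkcond /=.
    by apply: eq_bigr => b _; rewrite !inE eq_sym; case: (_ == _).
  by case: (val a == 0); lia.
rewrite (sum_ord_val0 nat_of_bool) //= big1; lia.
Qed.

(** The three terms come from the hub, the other clique vertices and the leaves; [F] is later the
    identity and the square. *)
Lemma sum_deg_Gbar (F : nat -> nat) :
  \sum_u F (deg (Gbar n k) u) = F n.-1 + m.-1 * F m.-1 + k * F 1.
Proof.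
have m_gt0 : 0 < m by rewrite subn_gt0.
rewrite big_sumType /=; under eq_bigr do rewrite deg_Gbar.
under [X in _ + X]eq_bigr do rewrite deg_Gbar.
rewrite (sum_ord_val0 (fun b => F (if b then n.-1 else m.-1))) //.
by rewrite sum_nat_const card_ord.
Qed.

Lemma Gbar_common_neighbour (u w : 'I_m + 'I_k) : u != w -> ~~ Gbar n k u w ->
  exists z, Gbar n k u z && Gbar n k z w.
Proof.
have m_gt0 : 0 < m by rewrite subn_gt0.
(* The hub is adjacent to every other vertex. *)
move=> uw nuw; exists (inl (Ordinal m_gt0)).
case: u w uw nuw => [a|a] [b|b] //=.
- by move=> ne /negPn/eqP ab; rewrite ab eqxx in ne.
- by rewrite andbT -val_eqE.
- by rewrite -[_ == b]val_eqE /= eq_sym.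
Qed.

End GbarDegrees.

(** * Invariance of degree sums under isomorphism *)

Section Iso.
Variables (T U : finType) (e : rel T) (e' : rel U) (f : T -> U).
Hypotheses (f_bij : bijective f) (fE : forall x y, e' (f x) (f y) = e x y).

Lemma deg_iso x : deg e' (f x) = deg e x.
Proof.
rewrite !degE (reindex f) /=; last exact: onW_bij.
by apply: eq_bigr => y _; rewrite fE.
Qed.

Lemma sum_deg_iso (F : nat -> nat) : \sum_x F (deg e x) = \sum_u F (deg e' u).
Proof.
rewrite [RHS](reindex f) /=; last exact: onW_bij.
by apply: eq_bigr => y _; rewrite deg_iso.
Qed.

End Iso.

(** * Bounding the reciprocal degree distance by degree sums *)

Section RDDBound.
Variables (T : finType) (e : rel T).
Hypotheses (e_sym : symmetric e) (e_irr : irreflexive e) (e_conn : connected_graph e).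
Local Notation n := #|T|.

(** For distinct vertices at distance 1 or 2, the factor 2 or 1 is twice the reciprocal distance;
    doubling keeps the weight in [nat]. *)
Definition pair_weight (p : T * T) : nat := (deg e p.1 + deg e p.2) * (1 + e p.1 p.2).

(** Doubling passes to ordered pairs. The summand 1 then gives a sum over the complete graph [ne],
    the summand [e p.1 p.2] one over [e], and [handshake] evaluates both. *)
Lemma sum_pair_weight :
  \sum_(p : T * T | enum_rank p.1 < enum_rank p.2) pair_weight p
  = n.-1 * \sum_x deg e x + \sum_x deg e x ^ 2.
Proof.
pose ne : rel T := [rel x y | x != y].
have ne_sym : symmetric ne by move=> x y; rewrite /ne /= eq_sym.
have deg_ne x : deg ne x = n.-1.
  by rewrite -(cardsC1 x); apply: eq_card => y; rewrite !inE eq_sym.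
apply/eqP; rewrite -(eqn_pmul2l (isT : 0 < 2)); apply/eqP.
transitivity (\sum_(p | ne p.1 p.2) pair_weight p).
  rewrite [RHS](bigID (fun p : T * T => enum_rank p.1 < enum_rank p.2)) /= mul2n -addnn.
  congr (_ + _).
    apply: eq_bigl => p; rewrite /ne /= andbC; case: ltnP => //= lt.
    by apply/esym; apply: contraTneq lt => ->; rewrite ltnn.
  rewrite (reindex_inj (h := fun p : T * T => (p.2, p.1))) /=; last first.
    by move=> [a b] [c d] [-> ->].
  apply: eq_big => p; last first.
    by move=> _; rewrite /pair_weight /= e_sym [deg e p.2 + _]addnC.
  rewrite /ne /= -leqNgt ltn_neqAle; congr (_ && _).
  by rewrite -(inj_eq enum_rank_inj) -val_eqE /= eq_sym.
transitivity (\sum_(p | ne p.1 p.2) (deg e p.1 + deg e p.2)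
   + \sum_(p | e p.1 p.2) (deg e p.1 + deg e p.2)).
  rewrite [X in _ + X](eq_bigl (fun p => ne p.1 p.2 && e p.1 p.2)); last first.
    move=> p; rewrite /ne /=; case: eqVneq => //= ->; exact: e_irr.
  rewrite big_mkcondr -big_split /=; apply: eq_bigr => p _.
  by rewrite /pair_weight; case: (e _ _); lia.
rewrite -!handshake // mulnDr; congr (_ + _); congr (_ * _).
  by rewrite mulnC big_distrl /=; apply: eq_bigr => x _; rewrite deg_ne.
Qed.

Local Open Scope ring_scope.

(** The comparison is termwise. Degree sums are positive by connectedness, so a nonadjacent pair
    attains equality only at distance exactly 2. *)
Lemma RDD_le_pair_weight :
  RDD e <= (\sum_(p : T * T | (enum_rank p.1 < enum_rank p.2)%N) pair_weight p)%:R / 2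
    ?= iff [forall (p : T * T | (enum_rank p.1 < enum_rank p.2)%N),
             e p.1 p.2 || (dist e p.1 p.2 == 2)].
Proof.
rewrite natr_sum mulr_suml; apply: leif_sum => -[x y] /= lt.
have xy : x != y by apply: contraTneq lt => ->; rewrite ltnn.
have d0 : (0 < deg e x + deg e y)%N by rewrite addn_gt0 (deg_gt0 e_conn xy).
rewrite /pair_weight /= natrM.
have D0 : 0 < (deg e x + deg e y)%:R :> rat by rewrite ltr0n.
set D := (deg e x + deg e y)%:R in D0 *.
have [exy|nexy] := boolP (e x y).
  rewrite (dist_adj e_irr e_conn exy) divr1 /=.
  have -> : D * (1 + 1)%N%:R / 2 = D by field.
  exact/leif_refl.
rewrite /= addn0 mulr1.
have := dist_nonadj e_conn xy nexy; set l := dist e x y => l2.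
have l0 : 0 < l%:R :> rat by rewrite ltr0n; lia.
split; first by rewrite ler_pM2l // lef_pV2 ?posrE // ler_nat.
apply/eqP/eqP => [/(mulfI (lt0r_neq0 D0)) /invr_inj /eqP|->//].
by rewrite eqr_nat => /eqP.
Qed.

Lemma diam2_pairs :
  [forall (p : T * T | (enum_rank p.1 < enum_rank p.2)%N),
     e p.1 p.2 || (dist e p.1 p.2 == 2)]
  <-> forall x y, x != y -> ~~ e x y -> exists z, e x z && e z y.
Proof.
split=> [/forall_inP H x y xy nxy|H]; last first.
  apply/forall_inP => -[x y] /= lt.
  have xy : x != y by apply: contraTneq lt => ->; rewrite ltnn.
  by have [//|nxy] := boolP (e x y); apply/(dist_eq2P e_irr e_conn xy nxy)/H.
wlog lt : x y xy nxy / (enum_rank x < enum_rank y)%N.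
  move=> W; case: (ltngtP (enum_rank x) (enum_rank y)) => [|lt|/val_inj/enum_rank_inj E].
  - exact: W.
  - have [|| |z xzy] := W y x; rewrite 1?eq_sym 1?e_sym //.
    by exists z; rewrite andbC [e z y]e_sym [e x z]e_sym.
  - by rewrite E eqxx in xy.
have := H (x, y) lt; rewrite /= (negPf nxy) /=.
by move/(dist_eq2P e_irr e_conn xy nxy).
Qed.

Lemma RDD_le_degrees :
  RDD e <= (n.-1 * \sum_x deg e x + \sum_x deg e x ^ 2)%N%:R / 2.
Proof. by have [+ _] := RDD_le_pair_weight; rewrite sum_pair_weight. Qed.

Lemma RDD_eq_degrees :
  RDD e = (n.-1 * \sum_x deg e x + \sum_x deg e x ^ 2)%N%:R / 2
  <-> forall x y, x != y -> ~~ e x y -> exists z, e x z && e z y.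
Proof.
have [_] := RDD_le_pair_weight; rewrite sum_pair_weight => E.
split=> [/eqP|/diam2_pairs]; first by rewrite E => /diam2_pairs.
by rewrite -E => /eqP.
Qed.

End RDDBound.

(** * Combining the two degree inequalities, and the equality case *)

Local Open Scope ring_scope.

Theorem theorem4p3 (n k : nat) (T : finType) (e : rel T)
    (n_ge1 : (1 <= n)%N)
    (e_simple : simple_graph e)
    (e_conn : connected_graph e)
    (e_order : #|T| = n)
    (e_cut : #|cut_edges e| = k) :
  let N : rat := n%:R in
  let K : rat := k%:R in
  let bound : rat :=
    N ^+ 3 - (5 / 2 * K + 2) * N ^+ 2
    + (2 * K ^+ 2 + 11 / 2 * K + 1) * N
    - (1 / 2 * K ^+ 3 + 2 * K ^+ 2 + 5 / 2 * K) in
  RDD e <= bound /\ (RDD e = bound <-> graph_iso e (Gbar n k)).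
Proof.
move=> N K bound; have [e_sym e_irr] := e_simple.
have T0 : (0 < #|T|)%N by rewrite e_order.
have kn : (k < n)%N by rewrite -e_order -e_cut; exact: card_cut_edges_lt.
(* With M = n - k - 1 the truncated subtractions disappear. *)
have [M Mdef] : exists M, (n - k)%N = M.+1.
  by exists (n - k).-1; rewrite prednK // subn_gt0.
have nE : n = (k + M).+1 by rewrite -addnS -Mdef subnKC // ltnW.
have := RDD_le_degrees e_sym e_irr e_conn.
have := RDD_eq_degrees e_sym e_irr e_conn.
set S := (\sum_x deg e x)%N; set Q := (\sum_x deg e x ^ 2)%N.
rewrite e_order => RDDeq RDDle.
have leS : (S <= (n - k) * (n - k).-1 + 2 * k)%N.
  by rewrite -e_order -e_cut; exact: sum_deg_le.
have leQ : (Q + k * (n - k).-1 <= k * n + (n - k).-1 * S)%N.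
  by rewrite -e_order -e_cut; exact: sum_sqr_deg_le.
pose S0 := (M.+1 * M + 2 * k)%N.
(* Twice the total slack. Replacing Q by its bound gives S the coefficient (n-1) + M = k + 2M, which
   therefore weights the slack of S. *)
pose gap := ((k + 2 * M) * (S0 - S) + (k * n + M * S - (Q + k * M)))%N.
have leS0 : (S <= S0)%N by rewrite /S0; move: leS; rewrite Mdef.
have leQ0 : (Q + k * M <= k * n + M * S)%N by move: leQ; rewrite Mdef.
have boundE : (n.-1 * S + Q)%:R / 2 + gap%:R / 2 = bound.
  have NE : N = K + M%:R + 1 by rewrite /N nE -addn1 !natrD.
  have gapE : gap%:R = (K + 2 * M%:R) * (((M%:R + 1) * M%:R + 2 * K) - S%:R)
      + (K * N + M%:R * S%:R - (Q%:R + K * M%:R)) :> rat.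
    by rewrite /gap natrD natrM !natrB // /S0 !(natrD, natrM) -[M.+1%:R]natr1.
  rewrite gapE natrD natrM /bound NE nE /= natrD -/K; by field.
have le_bound : (n.-1 * S + Q)%:R / 2 <= bound by rewrite -boundE lerDl divr_ge0.
split; first exact: le_trans RDDle le_bound.
split=> [RDDE|[f f_bij fE]].
  have XE : (n.-1 * S + Q)%:R / 2 = bound.
    by apply/le_anti; rewrite le_bound -RDDE RDDle.
  have gap0 : gap = 0%N.
    apply/eqP; rewrite -(eqr_nat rat); apply/eqP.
    by move: boundE; rewrite XE; lra.
  have SE : S = S0.
    (* The weight k + 2M vanishes only for a single vertex, where [S0] is 0. *)
    move/eqP: gap0; rewrite addn_eq0 muln_eq0 => /andP[/orP[/eqP k2M|S0S] _]; last first.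
      by move: S0S; rewrite subn_eq0 => S0S; apply/eqP; rewrite eqn_leq leS0 S0S.
    have [k0 M0] : k = 0%N /\ M = 0%N by lia.
    by move: leS0; rewrite /S0 k0 M0 leqn0 => /eqP.
  have := graph_iso_Gbar e_sym e_irr T0; rewrite e_order e_cut; apply.
    by apply/RDDeq; rewrite RDDE XE.
  by rewrite -/S SE Mdef.
(* Conversely, common neighbours are pulled back from [Gbar] along the isomorphism; the explicit
   degrees then make both slacks zero. *)
have -> : RDD e = (n.-1 * S + Q)%:R / 2.
  apply/RDDeq => x y xy; rewrite -fE => nxy; have [g fK gK] := f_bij.
  have fxy : f x != f y by rewrite (inj_eq (can_inj fK)).
  have [z /andP[xz zy]] := Gbar_common_neighbour kn fxy nxy.
  by exists (g z); rewrite -!fE gK xz.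
have SE : S = (n.-1 + M * M + k * 1)%N.
  by rewrite /S (sum_deg_iso f_bij fE id) (sum_deg_Gbar kn id) Mdef.
have QE : Q = (n.-1 ^ 2 + M * M ^ 2 + k * 1 ^ 2)%N.
  by rewrite /Q (sum_deg_iso f_bij fE (expn^~ 2)) (sum_deg_Gbar kn (expn^~ 2)) Mdef.
have gap0 : gap = 0%N.
  have QSE : (k * n + M * S = Q + k * M)%N.
    by rewrite SE QE nE /= -[(k + M).+1]addn1; ring.
  have S0E : S0 = S by rewrite /S0 SE nE /= -[M.+1]addn1; ring.
  by rewrite /gap QSE S0E !subnn muln0.
by rewrite -boundE gap0 mul0r addr0.
Qed.
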